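(* Let $S$ be a proper totally umbilical PAInv-submanifold of a Kenmotsu manifold $\bar M$, with ambiguous distribution $\mathfrak D$ and anti-invariant distribution $\mathfrak D^\perp$. If the distribution $\mathfrak D\oplus\langle\xi\rangle$ is integrable and its leaves are totally geodesic in $S$, then $\mathcal H\in\Gamma(N\mathfrak D\oplus\mu)$, where $\mathcal H$ denotes the mean curvature vector field of $S$.
   Context: An almost contact metric manifold $(\bar M,\phi,\xi,\eta,g)$ is a Riemannian manifold $(\bar M,g)$ of dimension $2n+1$ with a $(1,1)$-tensor field $\phi$, a vector field $\xi$ and a 1-form $\eta$ such that $\phi^2=-I+\eta\otimes\xi$, $\eta(\xi)=1$, $\phi\xi=0$, $\eta\circ\phi=0$ and $g(\phi X,\phi Y)=g(X,Y)-\eta(X)\eta(Y)$. It is a Kenmotsu manifold if its Levi-Civita connection $\bar\nabla$ satisfies $(\bar\nabla_X\phi)Y=g(\phi X,Y)\xi-\eta(Y)\phi X$ (hence $\bar\nabla_X\xi=X-\eta(X)\xi$). Let $S$ be an immersed submanifold of $\bar M$ with $\xi$ tangent to $S$. For $X$ tangent to $S$ write $\phi X=TX+NX$ with $TX$ tangent and $NX$ normal to $S$. $S$ is a PAInv-submanifold (partially anti-invariant submanifold) if there are mutually orthogonal distributions $\mathfrak D$ (the ambiguous distribution) and $\mathfrak D^\perp$ on $S$ with orthogonal decomposition $TS=\mathfrak D\oplus\mathfrak D^\perp\oplus\langle\xi\rangle$, $\phi\mathfrak D^\perp\subseteq TS^\perp$ ($\mathfrak D^\perp$ is anti-invariant)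 and $T\mathfrak D\subseteq\mathfrak D$. It is proper if $\mathfrak D$ is neither invariant ($\phi\mathfrak D\subseteq\mathfrak D$), nor anti-invariant ($\phi\mathfrak D\subseteq TS^\perp$), nor slant, nor pointwise slant; here $\mathfrak D$ is slant (resp. pointwise slant) if the angle between $\phi Y$ and $\mathfrak D_p$, for nonzero $Y\in\mathfrak D_p$, is independent of $p$ and $Y$ (resp. depends only on $p$). The normal bundle decomposes orthogonally as $TS^\perp=\phi\mathfrak D^\perp\oplus N\mathfrak D\oplus\mu$, where $\mu$ is the orthogonal complementary subbundle of $\phi\mathfrak D^\perp\oplus N\mathfrak D$. With $\nabla$ the induced connection and $h$ the second fundamental form of $S$, $S$ is totally umbilical if $h(Z,W)=g(Z,W)\mathcal H$ for all $Z,W\in\Gamma(TS)$. Leaves of an integrable distribution $E$ on $S$ are totally geodesic in $S$ iff $\nabla_UV\in\Gamma(E)$ for all $U,V\in\Gamma(E)$. *)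

(* Defs.v *)
From HB Require Import structures.
From mathcomp Require Import all_boot all_order all_algebra.
From mathcomp Require Import all_classical all_reals all_analysis.
Set Implicit Arguments.
Unset Strict Implicit.
Unset Printing Implicit Defensive.
Import Order.TTheory GRing.Theory Num.Theory.
Import numFieldNormedType.Exports.
Local Open Scope classical_set_scope.
Local Open Scope ring_scope.

(** * Smooth manifolds *)

(* Only meaningful for open U: f is C^(k+1) on U iff it is differentiable on U
   with all its directional derivatives C^k on U (V finite dimensional). *)
Fixpoint Ck_on (R : realType) (V W : normedModType R) (k : nat)
    (U : set V) (f : V -> W) : Prop :=
  match k with
  | 0%N => forall x, U x -> {for x, continuous f}
  | k'.+1 => (forall x, U x -> differentiable f x) /\
             forall v : V, Ck_on k' U (fun x => 'D_v f x)
  end.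

Definition smooth_on (R : realType) (V W : normedModType R)
    (U : set V) (f : V -> W) : Prop := forall k : nat, Ck_on k U f.

(* cmap and cinv are total functions, with unspecified values outside cdom and
   cimg respectively. *)
Record chart (R : realType) (n : nat) (M : topologicalType) := Chart {
  cdom : set M;
  cimg : set 'rV[R]_n;
  cmap : M -> 'rV[R]_n;
  cinv : 'rV[R]_n -> M;
  cdom_open : open cdom;
  cimg_open : open cimg;
  cmap_img : forall p, cdom p -> cimg (cmap p);
  cinv_dom : forall x, cimg x -> cdom (cinv x);
  cmapK : forall p, cdom p -> cinv (cmap p) = p;
  cinvK : forall x, cimg x -> cmap (cinv x) = x;
  cmap_cont : forall p, cdom p -> {for p, continuous cmap};
  cinv_cont : forall x, cimg x -> {for x, continuous cinv}
}.

(* chart_at selects one chart of the atlas around each point.  It serves only to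
   identify the tangent space at p with 'rV[R]_n (see below); every notion
   defined in this file is independent of the selection. *)
Record manifold (R : realType) (n : nat) := Manifold {
  mcarrier :> topologicalType;
  atlas : set (chart R n mcarrier);
  chart_at : mcarrier -> chart R n mcarrier;
  chart_at_atlas : forall p, atlas (chart_at p);
  chart_at_dom : forall p, cdom (chart_at p) p;
  atlas_compat : forall c d, atlas c -> atlas d ->
    smooth_on [set x | cimg c x /\ cdom d (cinv c x)] (cmap d \o cinv c);
  manifold_hausdorff : hausdorff_space mcarrier;
  manifold_second_countable : @second_countable mcarrier
}.

(** * Tangent vectors *)

(* A tangent vector at p is represented by its components in chart_at p, so
   T_pM is 'rV[R]_n and a (rough) vector field is a function M -> 'rV[R]_n. *)
Definition vfield (R : realType) (n : nat) (M : manifold R n) : Type :=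
  M -> 'rV[R]_n.

(* The components, in the chart d, of the tangent vector v at p. *)
Definition components (R : realType) (n : nat) (M : manifold R n)
    (d : chart R n M) (p : M) (v : 'rV[R]_n) : 'rV[R]_n :=
  'd (cmap d \o cinv (chart_at p)) (cmap (chart_at p) p) v.

(* The derivative v(k) of the function k along the tangent vector v at p. *)
Definition dir_der (R : realType) (n : nat) (M : manifold R n)
    (p : M) (v : 'rV[R]_n) (k : M -> R) : R :=
  'd ((k : M -> R^o) \o cinv (chart_at p)) (cmap (chart_at p) p) v.

(* The differential T_pM -> T_(f p)N of f at p. *)
Definition dmap (R : realType) (m n : nat) (M : manifold R m) (N : manifold R n)
    (f : M -> N) (p : M) (v : 'rV[R]_m) : 'rV[R]_n :=
  'd (cmap (chart_at (f p)) \o f \o cinv (chart_at p)) (cmap (chart_at p) p) v.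

Definition smooth_fun (R : realType) (n : nat) (M : manifold R n)
    (k : M -> R) : Prop :=
  forall c, atlas c -> smooth_on (cimg c) ((k : M -> R^o) \o cinv c).

Definition smooth_map (R : realType) (m n : nat)
    (M : manifold R m) (N : manifold R n) (f : M -> N) : Prop :=
  continuous f /\
  forall c d, atlas c -> atlas d ->
    smooth_on [set x | cimg c x /\ cdom d (f (cinv c x))]
              (cmap d \o f \o cinv c).

Definition smooth_vfield (R : realType) (n : nat) (M : manifold R n)
    (X : vfield M) : Prop :=
  forall c, atlas c ->
    smooth_on (cimg c) (fun x => components c (cinv c x) (X (cinv c x))).

(* Smoothness of a section V of the pull-back bundle f^*TN. *)
Definition smooth_along (R : realType) (m n : nat)
    (M : manifold R m) (N : manifold R n) (f : M -> N)
    (V : M -> 'rV[R]_n) : Prop :=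
  forall c d, atlas c -> atlas d ->
    smooth_on [set x | cimg c x /\ cdom d (f (cinv c x))]
              (fun x => components d (f (cinv c x)) (V (cinv c x))).

Definition immersion (R : realType) (m n : nat)
    (M : manifold R m) (N : manifold R n) (f : M -> N) : Prop :=
  smooth_map f /\ forall p, injective (dmap f p).

(** * Distributions *)

(* A smooth subbundle of constant rank of the tangent bundle. *)
Definition tangent_distribution (R : realType) (m : nat) (S : manifold R m)
    (E : S -> {vspace 'rV[R]_m}) : Prop :=
  exists r : nat, (forall p, \dim (E p) = r) /\
  forall p : S, exists X : 'I_r -> vfield S,
    (forall i, smooth_vfield (X i)) /\
    \forall q \near p, E q = span [seq X i q | i <- enum 'I_r].

Definition vsection (R : realType) (m : nat) (S : manifold R m)
    (E : S -> {vspace 'rV[R]_m}) (X : vfield S) : Prop :=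
  smooth_vfield X /\ forall p, X p \in E p.

(* Through every point passes an immersed integral manifold of E. *)
Definition integrable_distribution (R : realType) (m : nat) (S : manifold R m)
    (E : S -> {vspace 'rV[R]_m}) : Prop :=
  forall p : S, exists (k : nat) (L : manifold R k) (j : L -> S),
    [/\ immersion j, exists q, j q = p &
        forall q v, v \in E (j q) <-> exists u, dmap j q u = v].

(** * Riemannian metrics and connections *)

Record riemannian_metric (R : realType) (n : nat) (M : manifold R n) :=
  RiemannianMetric {
  rmetric :> M -> 'rV[R]_n -> 'rV[R]_n -> R;
  rmetric_linear : forall p u, scalar (rmetric p u);
  rmetric_sym : forall p u v, rmetric p u v = rmetric p v u;
  rmetric_pos : forall p u, u != 0 -> 0 < rmetric p u u;
  rmetric_smooth : forall X Y : vfield M, smooth_vfield X -> smooth_vfield Y ->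
    smooth_fun (fun p => rmetric p (X p) (Y p))
}.

(* nabla p v Y stands for (nabla_v Y)_p, with v a tangent vector at p. *)
Definition connection (R : realType) (n : nat) (M : manifold R n) : Type :=
  M -> 'rV[R]_n -> vfield M -> 'rV[R]_n.

Record affine_connection (R : realType) (n : nat) (M : manifold R n)
    (nabla : connection M) : Prop := AffineConnection {
  connection_linear : forall p a u v (Y : vfield M), smooth_vfield Y ->
    nabla p (a *: u + v) Y = a *: nabla p u Y + nabla p v Y;
  connection_add : forall p v (Y Z : vfield M),
    smooth_vfield Y -> smooth_vfield Z ->
    nabla p v (fun q => Y q + Z q) = nabla p v Y + nabla p v Z;
  connection_leibniz : forall p v (k : M -> R) (Y : vfield M),
    smooth_fun k -> smooth_vfield Y ->
    nabla p v (fun q => k q *: Y q) = dir_der p v k *: Y p + k p *: nabla p v Y;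
  connection_smooth : forall X Y : vfield M,
    smooth_vfield X -> smooth_vfield Y ->
    smooth_vfield (fun p => nabla p (X p) Y)
}.

(* In torsion_free both sides are the derivative of k along [X, Y]. *)
Record levi_civita (R : realType) (n : nat) (M : manifold R n)
    (g : riemannian_metric M) (nabla : connection M) : Prop := LeviCivita {
  levi_civita_affine : affine_connection nabla;
  torsion_free : forall (X Y : vfield M) (k : M -> R),
    smooth_vfield X -> smooth_vfield Y -> smooth_fun k ->
    forall p, dir_der p (nabla p (X p) Y - nabla p (Y p) X) k =
      dir_der p (X p) (fun q => dir_der q (Y q) k) -
      dir_der p (Y p) (fun q => dir_der q (X q) k);
  metric_compatible : forall Y Z : vfield M,
    smooth_vfield Y -> smooth_vfield Z ->
    forall p v, dir_der p v (fun q => g q (Y q) (Z q)) =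
      g p (nabla p v Y) (Z p) + g p (Y p) (nabla p v Z)
}.

(** * Almost contact metric and Kenmotsu structures *)

Record almost_contact_metric (R : realType) (n : nat)
    (M : manifold R n.*2.+1) := AlmostContactMetric {
  acm_g :> riemannian_metric M;
  acm_phi : M -> {linear 'rV[R]_(n.*2.+1) -> 'rV[R]_(n.*2.+1)};
  acm_xi : vfield M;
  acm_eta : M -> {scalar 'rV[R]_(n.*2.+1)};
  acm_phi_smooth : forall X : vfield M, smooth_vfield X ->
    smooth_vfield (fun p => acm_phi p (X p));
  acm_xi_smooth : smooth_vfield acm_xi;
  acm_eta_smooth : forall X : vfield M, smooth_vfield X ->
    smooth_fun (fun p => acm_eta p (X p));
  acm_phi2 : forall p v,
    acm_phi p (acm_phi p v) = - v + acm_eta p v *: acm_xi p;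
  acm_eta_xi : forall p, acm_eta p (acm_xi p) = 1;
  acm_phi_xi : forall p, acm_phi p (acm_xi p) = 0;
  acm_eta_phi : forall p v, acm_eta p (acm_phi p v) = 0;
  acm_metric : forall p u v,
    acm_g p (acm_phi p u) (acm_phi p v) =
    acm_g p u v - acm_eta p u * acm_eta p v
}.

(* nabla is meant to be the Levi-Civita connection of A. *)
Definition kenmotsu (R : realType) (n : nat) (M : manifold R n.*2.+1)
    (A : almost_contact_metric M) (nabla : connection M) : Prop :=
  forall X Y : vfield M, smooth_vfield X -> smooth_vfield Y ->
  forall p,
    nabla p (X p) (fun q => acm_phi A q (Y q)) -
      acm_phi A p (nabla p (X p) Y) =
    A p (acm_phi A p (X p)) (Y p) *: acm_xi A p -
      acm_eta A p (Y p) *: acm_phi A p (X p).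

(** * Immersed submanifolds *)

(* Vectors of T_(f p)M normal to the image of T_pS. *)
Definition normal_at (R : realType) (m n : nat) (M : manifold R n)
    (g : riemannian_metric M) (S : manifold R m) (f : S -> M)
    (p : S) : set 'rV[R]_n :=
  [set w | forall u, g (f p) w (dmap f p u) = 0].

(* The metric induced on S. *)
Definition induced_metric (R : realType) (m n : nat) (M : manifold R n)
    (g : riemannian_metric M) (S : manifold R m) (f : S -> M)
    (p : S) (u v : 'rV[R]_m) : R :=
  g (f p) (dmap f p u) (dmap f p v).

(* For an immersion f, the unique t in E such that w - df(t) is orthogonal to
   df(E), that is, the orthogonal projection of w to df(E). *)
Definition orth_proj (R : realType) (m n : nat) (M : manifold R n)
    (g : riemannian_metric M) (S : manifold R m) (f : S -> M)
    (p : S) (E : {vspace 'rV[R]_m}) (w : 'rV[R]_n) : 'rV[R]_m :=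
  xget 0 [set t | t \in E /\
    forall u, u \in E -> g (f p) (w - dmap f p t) (dmap f p u) = 0].

Definition tan_part (R : realType) (m n : nat) (M : manifold R n)
    (g : riemannian_metric M) (S : manifold R m) (f : S -> M)
    (p : S) (w : 'rV[R]_n) : 'rV[R]_m :=
  orth_proj g f p fullv w.

Definition nor_part (R : realType) (m n : nat) (M : manifold R n)
    (g : riemannian_metric M) (S : manifold R m) (f : S -> M)
    (p : S) (w : 'rV[R]_n) : 'rV[R]_n :=
  w - dmap f p (tan_part g f p w).

(* The Gauss formula, which characterizes the induced connection nablaS and the
   second fundamental form h.  The ambient field Y' is any extension of Y near
   p; for an immersion, one exists around every point. *)
Record gauss_formula (R : realType) (m n : nat) (M : manifold R n)
    (g : riemannian_metric M) (nabla : connection M)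
    (S : manifold R m) (f : S -> M) (nablaS : connection S)
    (h : S -> 'rV[R]_m -> 'rV[R]_m -> 'rV[R]_n) : Prop := GaussFormula {
  gauss_eq : forall (p : S) v (Y : vfield S) (Y' : vfield M),
    smooth_vfield Y -> smooth_vfield Y' ->
    (\forall q \near p, Y' (f q) = dmap f q (Y q)) ->
    nabla (f p) (dmap f p v) Y' = dmap f p (nablaS p v Y) + h p v (Y p);
  gauss_normal : forall p u v, normal_at g f p (h p u v)
}.

(* (dim S)^-1 times the metric trace of h: with g_ij the induced metric in the
   standard basis of T_pS, this is m^-1 g^ij h_ij. *)
Definition mean_curvature (R : realType) (m n : nat) (M : manifold R n)
    (g : riemannian_metric M) (S : manifold R m) (f : S -> M)
    (h : S -> 'rV[R]_m -> 'rV[R]_m -> 'rV[R]_n) (p : S) : 'rV[R]_n :=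
  let e (i : 'I_m) : 'rV[R]_m := delta_mx 0 i in
  let G : 'M[R]_m := \matrix_(i, j) induced_metric g f p (e i) (e j) in
  m%:R^-1 *: \sum_i \sum_j invmx G i j *: h p (e i) (e j).

Definition totally_umbilical (R : realType) (m n : nat) (M : manifold R n)
    (g : riemannian_metric M) (S : manifold R m) (f : S -> M)
    (h : S -> 'rV[R]_m -> 'rV[R]_m -> 'rV[R]_n) : Prop :=
  forall Z W : vfield S, smooth_vfield Z -> smooth_vfield W ->
  forall p, h p (Z p) (W p) =
    induced_metric g f p (Z p) (W p) *: mean_curvature g f h p.

(* For an integrable distribution E on S with induced connection nablaS. *)
Definition totally_geodesic_leaves (R : realType) (m : nat) (S : manifold R m)
    (nablaS : connection S) (E : S -> {vspace 'rV[R]_m}) : Prop :=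
  forall U V : vfield S, vsection E U -> vsection E V ->
    vsection E (fun p => nablaS p (U p) V).

(** * Partially anti-invariant submanifolds *)

(* phi applied to the vector u tangent to S; phi X = T X + N X. *)
Definition phiS (R : realType) (m n : nat) (M : manifold R n.*2.+1)
    (A : almost_contact_metric M) (S : manifold R m) (f : S -> M)
    (p : S) (u : 'rV[R]_m) : 'rV[R]_(n.*2.+1) :=
  acm_phi A (f p) (dmap f p u).

Definition opT (R : realType) (m n : nat) (M : manifold R n.*2.+1)
    (A : almost_contact_metric M) (S : manifold R m) (f : S -> M)
    (p : S) (u : 'rV[R]_m) : 'rV[R]_m :=
  tan_part A f p (phiS A f p u).

Definition opN (R : realType) (m n : nat) (M : manifold R n.*2.+1)
    (A : almost_contact_metric M) (S : manifold R m) (f : S -> M)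
    (p : S) (u : 'rV[R]_m) : 'rV[R]_(n.*2.+1) :=
  nor_part A f p (phiS A f p u).

(* xi is tangent to S, and xiS is xi regarded as a vector field on S. *)
Definition tangent_to (R : realType) (m n : nat) (M : manifold R n)
    (S : manifold R m) (f : S -> M) (X : vfield M) (XS : vfield S) : Prop :=
  smooth_vfield XS /\ forall p, dmap f p (XS p) = X (f p).

Definition phi_anti_invariant (R : realType) (m n : nat)
    (M : manifold R n.*2.+1)
    (A : almost_contact_metric M) (S : manifold R m) (f : S -> M)
    (E : S -> {vspace 'rV[R]_m}) : Prop :=
  forall p u, u \in E p -> normal_at A f p (phiS A f p u).

Definition phi_invariant (R : realType) (m n : nat) (M : manifold R n.*2.+1)
    (A : almost_contact_metric M) (S : manifold R m) (f : S -> M)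
    (E : S -> {vspace 'rV[R]_m}) : Prop :=
  forall p u, u \in E p -> exists2 t, t \in E p & phiS A f p u = dmap f p t.

Definition gnorm (R : realType) (n : nat) (M : manifold R n)
    (g : riemannian_metric M) (p : M) (w : 'rV[R]_n) : R :=
  Num.sqrt (g p w w).

(* The angle between phi u and the subspace df(E p), that is, between phi u and
   its orthogonal projection to this subspace. *)
Definition slant_angle (R : realType) (m n : nat) (M : manifold R n.*2.+1)
    (A : almost_contact_metric M) (S : manifold R m) (f : S -> M)
    (E : S -> {vspace 'rV[R]_m}) (p : S) (u : 'rV[R]_m) : R :=
  acos (gnorm A (f p) (dmap f p (orth_proj A f p (E p) (phiS A f p u))) /
        gnorm A (f p) (phiS A f p u)).

Definition slant (R : realType) (m n : nat) (M : manifold R n.*2.+1)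
    (A : almost_contact_metric M) (S : manifold R m) (f : S -> M)
    (E : S -> {vspace 'rV[R]_m}) : Prop :=
  exists theta : R, forall p u, u \in E p -> u != 0 ->
    slant_angle A f E p u = theta.

Definition pointwise_slant (R : realType) (m n : nat) (M : manifold R n.*2.+1)
    (A : almost_contact_metric M) (S : manifold R m) (f : S -> M)
    (E : S -> {vspace 'rV[R]_m}) : Prop :=
  forall p, exists theta : R, forall u, u \in E p -> u != 0 ->
    slant_angle A f E p u = theta.

(* The sum in painv_sum is direct because its summands are orthogonal. *)
Record painv_submanifold (R : realType) (m n : nat) (M : manifold R n.*2.+1)
    (A : almost_contact_metric M) (S : manifold R m) (f : S -> M)
    (xiS : vfield S) (D Dperp : S -> {vspace 'rV[R]_m}) : Prop :=
  PAInvSubmanifold {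
  painv_D : tangent_distribution D;
  painv_Dperp : tangent_distribution Dperp;
  painv_sum : forall p, (D p + Dperp p + <[xiS p]>)%VS = fullv;
  painv_orth : forall p u v, u \in D p -> v \in Dperp p ->
    induced_metric A f p u v = 0;
  painv_orth_xi : forall p u, u \in D p -> induced_metric A f p u (xiS p) = 0;
  painv_orth_xi_perp : forall p v, v \in Dperp p ->
    induced_metric A f p v (xiS p) = 0;
  painv_anti : phi_anti_invariant A f Dperp;
  painv_T : forall p u, u \in D p -> opT A f p u \in D p
}.

Definition proper_painv (R : realType) (m n : nat) (M : manifold R n.*2.+1)
    (A : almost_contact_metric M) (S : manifold R m) (f : S -> M)
    (D : S -> {vspace 'rV[R]_m}) : Prop :=
  [/\ ~ phi_invariant A f D, ~ phi_anti_invariant A f D,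
      ~ slant A f D & ~ pointwise_slant A f D].

Definition phi_img (R : realType) (m n : nat) (M : manifold R n.*2.+1)
    (A : almost_contact_metric M) (S : manifold R m) (f : S -> M)
    (E : S -> {vspace 'rV[R]_m}) (p : S) : set 'rV[R]_(n.*2.+1) :=
  [set phiS A f p u | u in [set u | u \in E p]].

Definition N_img (R : realType) (m n : nat) (M : manifold R n.*2.+1)
    (A : almost_contact_metric M) (S : manifold R m) (f : S -> M)
    (E : S -> {vspace 'rV[R]_m}) (p : S) : set 'rV[R]_(n.*2.+1) :=
  [set opN A f p u | u in [set u | u \in E p]].

(* The orthogonal complement of phi(Dperp) + N(D) in the normal space at p. *)
Definition mu_normal (R : realType) (m n : nat) (M : manifold R n.*2.+1)
    (A : almost_contact_metric M) (S : manifold R m) (f : S -> M)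
    (D Dperp : S -> {vspace 'rV[R]_m}) (p : S) : set 'rV[R]_(n.*2.+1) :=
  [set w | [/\ normal_at A f p w,
    forall z, phi_img A f Dperp p z -> A (f p) w z = 0 &
    forall z, N_img A f D p z -> A (f p) w z = 0]].

(* Smooth sections along f of the bundle N(D) + mu. *)
Definition section_ND_mu (R : realType) (m n : nat) (M : manifold R n.*2.+1)
    (A : almost_contact_metric M) (S : manifold R m) (f : S -> M)
    (D Dperp : S -> {vspace 'rV[R]_m}) (V : S -> 'rV[R]_(n.*2.+1)) : Prop :=
  smooth_along f V /\
  forall p, exists a b,
    [/\ N_img A f D p a, mu_normal A f D Dperp p b & V p = a + b].

(* Main.v *)
Require Import Defs.
From mathcomp Require Import all_boot all_order all_algebra.
From mathcomp Require Import all_classical all_reals all_analysis.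

(** The mean curvature vector field [H] vanishes identically, so it is a
    section of every subbundle of the normal bundle.  In a Kenmotsu manifold
    the integral curves of [xi] are geodesics (lemma [nabla_xi_xi]).  When [xi]
    is tangent to [S], the Gauss formula splits [nabla_xi xi = 0] into a tangent
    and a normal part, so [h(xi, xi) = 0] (lemma [sff_xi_xi]).  Umbilicity gives
    [h(xi, xi) = g(xi, xi) H = H], hence [H = 0]
    (lemma [umbilical_mean_curvature0]). *)

Set Implicit Arguments.
Unset Strict Implicit.
Unset Printing Implicit Defensive.
Import Order.TTheory GRing.Theory Num.Theory.
Import numFieldNormedType.Exports.
Local Open Scope classical_set_scope.
Local Open Scope ring_scope.

Lemma Ck_on_cst (R : realType) (V W : normedModType R) (k : nat) (U : set V)
  (c : W) : Ck_on k U (fun=> c).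
Proof.
elim: k c => [|k IHk] c /=; first by move=> x _; exact: cst_continuous.
split=> [x _|v]; first exact: differentiable_cst.
have -> : (fun x : V => 'D_v (fun=> c) x) = (fun=> 0).
  by apply/funext => x; exact: derive_cst.
exact: IHk.
Qed.

Lemma dir_der_cst (R : realType) (n : nat) (M : manifold R n) (p : M)
  (v : 'rV[R]_n) (c : R) : dir_der p v (fun=> c) = 0.
Proof.
rewrite /dir_der; have -> : ((fun=> c) : M -> R^o) \o cinv (chart_at p) = cst c.
  by [].
by rewrite diff_cst.
Qed.

Lemma smooth_along0 (R : realType) (m n : nat) (M : manifold R m)
  (N : manifold R n) (f : M -> N) : smooth_along f (fun=> 0).
Proof.
move=> c d _ _ k.
have -> : (fun x => components d (f (cinv c x)) 0) = (fun=> 0).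
  by apply/funext => x; rewrite /components linear0.
exact: Ck_on_cst.
Qed.

Lemma dmap0 (R : realType) (m n : nat) (M : manifold R m) (N : manifold R n)
  (f : M -> N) (p : M) : dmap f p 0 = 0.
Proof. by rewrite /dmap linear0. Qed.

Lemma connection0 (R : realType) (n : nat) (M : manifold R n)
  (nabla : connection M) : affine_connection nabla ->
  forall p v, smooth_vfield (fun _ : M => 0) -> nabla p v (fun=> 0) = 0.
Proof.
move=> hA p v s0; have := connection_add hA p v s0 s0.
have -> : (fun _ : M => 0 + 0 : 'rV[R]_n) = (fun=> 0).
  by apply/funext => q; rewrite addr0.
by move/eqP; rewrite -subr_eq0 opprD addNKr oppr_eq0 => /eqP.
Qed.

Section Metric.
Context (R : realType) (n : nat) (M : manifold R n) (g : riemannian_metric M).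

Lemma rmetricDr p u v w : g p u (v + w) = g p u v + g p u w.
Proof. by have := rmetric_linear g p u 1 v w; rewrite scale1r mul1r. Qed.

Lemma rmetric0r p u : g p u 0 = 0.
Proof. by apply: (addrI (g p u 0)); rewrite -rmetricDr !addr0. Qed.

Lemma rmetricZr p u a v : g p u (a *: v) = a * g p u v.
Proof. by have := rmetric_linear g p u a v 0; rewrite rmetric0r !addr0. Qed.

Lemma rmetric0l p u : g p 0 u = 0.
Proof. by rewrite rmetric_sym rmetric0r. Qed.

Lemma rmetric_eq0 p u : g p u u = 0 -> u = 0.
Proof.
by move=> guu; apply/eqP/negPn/negP => /(rmetric_pos g p); rewrite guu ltxx.
Qed.

End Metric.

Lemma orth_proj0 (R : realType) (m n : nat) (M : manifold R n)
  (g : riemannian_metric M) (S : manifold R m) (f : S -> M) (p : S)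
  (E : {vspace 'rV[R]_m}) : dmap f p (orth_proj g f p E 0) = 0.
Proof.
rewrite /orth_proj; case: xgetP => [t _ [tE /(_ t tE)]|_]; last exact: dmap0.
rewrite sub0r rmetric_sym -scaleN1r rmetricZr mulN1r => /eqP.
by rewrite oppr_eq0 => /eqP; exact: rmetric_eq0.
Qed.

Section AlmostContact.
Context (R : realType) (n : nat) (M : manifold R n.*2.+1).
Context (A : almost_contact_metric M).

Lemma acm_xi_unit p : A p (acm_xi A p) (acm_xi A p) = 1.
Proof.
have := acm_metric A p (acm_xi A p) (acm_xi A p).
by rewrite acm_phi_xi rmetric0l acm_eta_xi mulr1 => /esym/eqP;
  rewrite subr_eq0 => /eqP.
Qed.

(** The Kenmotsu identity with both arguments equal to [xi] says that
    [phi (nabla_xi xi) = 0], so [nabla_xi xi] is a multiple of [xi]; it is also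
    orthogonal to [xi], because [xi] has constant length. *)
Lemma nabla_xi_xi (nabla : connection M) :
  levi_civita A nabla -> kenmotsu A nabla ->
  forall p, nabla p (acm_xi A p) (acm_xi A) = 0.
Proof.
move=> hLC hK p; have sxi := acm_xi_smooth A.
set w := nabla p _ _.
have phixi : (fun q => acm_phi A q (acm_xi A q)) = (fun=> 0).
  by apply/funext => q; rewrite acm_phi_xi.
have s0 : smooth_vfield (fun _ : M => 0).
  by rewrite -phixi; exact: acm_phi_smooth.
have phiw : acm_phi A p w = 0.
  have := hK _ _ sxi sxi p.
  rewrite phixi (connection0 (levi_civita_affine hLC)) // acm_phi_xi.
  by rewrite rmetric0l scale0r scaler0 subr0 sub0r => /eqP;
    rewrite oppr_eq0 => /eqP.
have wxi : w = acm_eta A p w *: acm_xi A p.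
  have := acm_phi2 A p w; rewrite phiw linear0 => /esym/eqP.
  by rewrite addrC subr_eq0 => /eqP.
have gxiw : A p (acm_xi A p) w = 0.
  have := metric_compatible hLC sxi sxi p (acm_xi A p).
  have -> : (fun q => A q (acm_xi A q) (acm_xi A q)) = (fun=> 1).
    by apply/funext => q; exact: acm_xi_unit.
  rewrite dir_der_cst -/w [A p w _]rmetric_sym -mulr2n => /esym/eqP.
  by rewrite mulrn_eq0 /= => /eqP.
move: gxiw; rewrite {1}wxi rmetricZr acm_xi_unit mulr1 => etaw.
by rewrite wxi etaw scale0r.
Qed.

Section Submanifold.
Context (m : nat) (S : manifold R m) (f : S -> M) (xiS : vfield S).
Context (nabla : connection M) (nablaS : connection S).
Context (h : S -> 'rV[R]_m -> 'rV[R]_m -> 'rV[R]_(n.*2.+1)).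
Hypotheses (hLC : levi_civita A nabla) (hK : kenmotsu A nabla).
Hypotheses (hxi : tangent_to f (acm_xi A) xiS).
Hypothesis hgauss : gauss_formula A nabla f nablaS h.

(** The field [xi] itself extends [xiS] in the Gauss formula, which makes
    [h(xi, xi)] the opposite of a tangent vector; being also normal, it is
    orthogonal to itself. *)
Lemma sff_xi_xi p : h p (xiS p) (xiS p) = 0.
Proof.
have [sxiS dxi] := hxi.
have ext : \forall q \near p, acm_xi A (f q) = dmap f q (xiS q).
  by near=> q; rewrite dxi.
have := gauss_eq hgauss (xiS p) sxiS (acm_xi_smooth A) ext.
rewrite dxi nabla_xi_xi //; set t := dmap f p _; set w := h _ _ _ => /esym tw.
apply: (@rmetric_eq0 _ _ _ A (f p)).
have := rmetricDr A (f p) w t w; rewrite tw rmetric0r.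
by rewrite (gauss_normal hgauss) add0r => <-.
Unshelve. all: by end_near.
Qed.

Lemma umbilical_mean_curvature0 p :
  totally_umbilical A f h -> mean_curvature A f h p = 0.
Proof.
have [sxiS dxi] := hxi; move=> /(_ _ _ sxiS sxiS p).
by rewrite sff_xi_xi /induced_metric dxi acm_xi_unit scale1r.
Qed.

End Submanifold.

Lemma section_ND_mu0 (m : nat) (S : manifold R m) (f : S -> M)
  (D Dperp : S -> {vspace 'rV[R]_m}) : section_ND_mu A f D Dperp (fun=> 0).
Proof.
split=> [|p]; first exact: smooth_along0.
exists 0, 0; split; last by rewrite addr0.
- exists 0; first exact: mem0v.
  by rewrite /opN /nor_part /tan_part /phiS dmap0 linear0 orth_proj0 subr0.
- by split=> [u|z _|z _]; exact: rmetric0l.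
Qed.

End AlmostContact.

Theorem proposition6 (R : realType) (n m : nat)
  (M : manifold R n.*2.+1) (A : almost_contact_metric M) (nabla : connection M)
  (hLC : levi_civita A nabla) (hK : kenmotsu A nabla)
  (S : manifold R m) (f : S -> M) (hf : immersion f)
  (xiS : vfield S) (hxi : tangent_to f (acm_xi A) xiS)
  (D Dperp : S -> {vspace 'rV[R]_m})
  (hPA : painv_submanifold A f xiS D Dperp) (hproper : proper_painv A f D)
  (nablaS : connection S) (h : S -> 'rV[R]_m -> 'rV[R]_m -> 'rV[R]_(n.*2.+1))
  (hgauss : gauss_formula A nabla f nablaS h)
  (humb : totally_umbilical A f h)
  (hint : integrable_distribution (fun p => D p + <[xiS p]>)%VS)
  (hgeo : totally_geodesic_leaves nablaS (fun p => D p + <[xiS p]>)%VS) :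
  section_ND_mu A f D Dperp (mean_curvature A f h).
Proof.
have -> : mean_curvature A f h = (fun=> 0).
  apply/funext => p.
  exact: (umbilical_mean_curvature0 hLC hK hxi hgauss p humb).
exact: section_ND_mu0.
Qed.
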